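(* Let $\bar\gamma_{\mathrm{R}},\bar\gamma_{\mathrm{D}},\bar\gamma_{\mathrm{E}}>0$ and $\mathcal{R}>0$. Let $h_{\mathrm{S},\mathrm{R}},h_{\mathrm{R},\mathrm{D}},h_{\mathrm{R},\mathrm{E}}$ be independent $\mathcal{CN}(0,1)$ random variables. Define $$\mathcal{R}^{1}_{\mathrm{R}\to\mathrm{D}}=\max\left\{\log_2\frac{1+\bar\gamma_{\mathrm{D}}|h_{\mathrm{R},\mathrm{D}}|^2}{1+\bar\gamma_{\mathrm{E}}|h_{\mathrm{R},\mathrm{E}}|^2},0\right\},\qquad \mathcal{R}^{1}_{\mathrm{S}\to\mathrm{R}}=\log_2\left(1+\bar\gamma_{\mathrm{R}}|h_{\mathrm{S},\mathrm{R}}|^2\right),$$ $$\mathcal{R}_1=\max\left\{\min\{\mathcal{R}^{1}_{\mathrm{R}\to\mathrm{D}},\mathcal{R}^{1}_{\mathrm{S}\to\mathrm{R}}\},0\right\},\qquad \mathcal{P}_1=\Pr(\mathcal{R}_1<\mathcal{R}).$$ Then $$\mathcal{P}_1=1-\mathrm{e}^{-\frac{2^{\mathcal{R}}-1}{\bar\gamma_{\mathrm{R}}}-\frac{2^{\mathcal{R}}-1}{\bar\gamma_{\mathrm{D}}}}\cdot\frac{1}{1+\frac{2^{\mathcal{R}}}{\bar\gamma_{\mathrm{D}}}\bar\gamma_{\mathrm{E}}}.$$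
   Context: This models a decode-and-forward relay system (source S, relay R, destination D, eavesdropper E) in which the eavesdropper overhears only the relay's transmission. $\mathcal{CN}(0,1)$ denotes a circularly symmetric complex Gaussian random variable with zero mean and unit variance (Rayleigh fading), so $|h|^2$ is exponentially distributed with mean 1. $\bar\gamma_{\mathrm{R}},\bar\gamma_{\mathrm{D}},\bar\gamma_{\mathrm{E}}$ are the average SNRs at the relay, destination and eavesdropper; $\mathcal{R}_1$ is the secrecy capacity and $\mathcal{P}_1$ the secrecy outage probability for target rate $\mathcal{R}$. *)

(* Defs.v *)
From HB Require Import structures.
From mathcomp Require Import all_boot all_order all_algebra.
From mathcomp Require Import all_classical all_reals all_analysis.
Set Implicit Arguments. Unset Strict Implicit. Unset Printing Implicit Defensive.
Import Order.TTheory GRing.Theory Num.Theory.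
Local Open Scope classical_set_scope.
Local Open Scope ring_scope.

Definition mutually_independent d (T : measurableType d) (R : realType)
    (P : probability T R) (I : finType) (X : I -> T -> R) : Prop :=
  (forall i, measurable_fun setT (X i)) /\
  forall (J : {set I}) (B : I -> set R), (forall i, measurable (B i)) ->
    P (\bigcap_(i in [set` J]) (X i @^-1` B i)) =
      (\prod_(i in J) fine (P (X i @^-1` B i)))%:E.

(* X has law N(m, s^2) (s = standard deviation). *)
Definition has_normal_law d (T : measurableType d) (R : realType)
    (P : probability T R) (X : T -> R) (m s : R) : Prop :=
  forall A : set R, measurable A -> P (X @^-1` A) = normal_prob m s A.

(* The six real components: (re, im) of h_SR, h_RD, h_RE. *)
Definition six_family (T : Type) (R : realType) (a1 b1 a2 b2 a3 b3 : T -> R)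
  (i : 'I_6) : T -> R := nth (fun _ => 0) [:: a1; b1; a2; b2; a3; b3] i.

(* h = a + i b is CN(0,1): a, b i.i.d. N(0, 1/2). Independence of the
   three complex gains together with circular symmetry = mutual
   independence of the six real components. *)
Definition indep_CN01_triple d (T : measurableType d) (R : realType)
    (P : probability T R) (a1 b1 a2 b2 a3 b3 : T -> R) : Prop :=
  mutually_independent P (six_family a1 b1 a2 b2 a3 b3) /\
  (forall i : 'I_6, has_normal_law P (six_family a1 b1 a2 b2 a3 b3 i) 0
                                     (Num.sqrt (2^-1))).

Definition log2 (R : realType) (x : R) : R := ln x / ln 2.

Definition abs2 (R : realType) (a b : R) : R := a ^+ 2 + b ^+ 2.

Definition rate_RD (R : realType) (gD gE : R) (hRD2 hRE2 : R) : R :=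
  Num.max (log2 ((1 + gD * hRD2) / (1 + gE * hRE2))) 0.

Definition rate_SR (R : realType) (gR : R) (hSR2 : R) : R :=
  log2 (1 + gR * hSR2).

Definition secrecy_capacity1 (R : realType) (gR gD gE hSR2 hRD2 hRE2 : R) : R :=
  Num.max (Num.min (rate_RD gD gE hRD2 hRE2) (rate_SR gR hSR2)) 0.

(* Main.v *)
(* Since R > 0, there is no outage exactly when
     |h_SR|^2 >= (2^R - 1) / gR  and  |h_RD|^2 >= c + k |h_RE|^2
   with c = (2^R - 1) / gD and k = 2^R gE / gD.  By independence its probability
   is a product of two factors.  The tail P(|h|^2 >= t) = e^-t of a CN(0,1)
   variable is obtained, without polar coordinates, from the substitution
   y = |x| u in the double Gaussian integral followed by Tonelli's theorem.
   Conditioning on h_RE, the second factor is E[e^(-c - k |h_RE|^2)], and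
   E[e^(-k |h|^2)] = 1 / (1 + k) as the square of a one-dimensional Gaussian
   integral. *)

Require Import Defs.
From HB Require Import structures.
From mathcomp Require Import all_boot all_order all_algebra.
From mathcomp Require Import all_classical all_reals all_analysis.
From mathcomp Require Import measurable_realfun ring.
Import Order.TTheory GRing.Theory Num.Theory.
Import numFieldNormedType.Exports.
Local Open Scope classical_set_scope.
Local Open Scope ring_scope.

(** * One-dimensional integrals over tails *)

(** The domain splits into two half-lines exchanged by x -> -x. They are disjoint only for b > 0;
    for b = 0 the domain is the whole line and the symmetry is applied there. *)
Lemma ge0_even_integral_tail {R : realType} (f : R -> R) (b : R) :
  (forall x, 0 <= f x) -> continuous f -> (forall x, f (- x) = f x) -> 0 <= b ->
  (\int[lebesgue_measure]_(x in [set x | b <= `|x|]%R) (f x)%:E =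
   2%:E * \int[lebesgue_measure]_(x in `[b, +oo[) (f x)%:E)%E.
Proof.
move=> f0 cf ef; rewrite le_eqVlt => /predU1P[<-|b0].
  rewrite (_ : [set x | _] = setT); last first.
    by apply/seteqP; split => x //= _.
  rewrite ge0_symfun_integralT//; last by move=> x /=; rewrite ef.
  by rewrite set_itvcy.
have mf : measurable_fun setT f by exact: continuous_measurable_fun.
rewrite (_ : [set x | _] = `]-oo, (- b)%R] `|` `[b, +oo[); last first.
  apply/seteqP; split => x /=; rewrite !in_itv/= andbT ler_normr lerNr.
    by move=> /orP; rewrite or_comm.
  by move=> h; apply/orP; rewrite or_comm.
rewrite ge0_integral_setU//=; last 3 first.
  exact/measurable_EFinP/measurable_funTS.
  by move=> x _; rewrite lee_fin.
  apply/disj_setPS => x [] /=; rewrite !in_itv/= andbT => h1 h2.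
  by have := le_trans h2 h1; rewrite leNgt (lt_trans _ b0)// oppr_lt0.
rewrite mule_natl mule2n; congr +%E.
rewrite ge0_integration_by_substitutionNy//.
- by apply: eq_integral => x _ /=; rewrite ef.
- exact: continuous_subspaceT.
Qed.

Lemma ge0_integral_tail_scale {R : realType} (f : R -> R) (b c : R) :
  (forall x, 0 <= f x) -> continuous f -> 0 < c ->
  (\int[lebesgue_measure]_(x in `[(c * b)%R, +oo[) (f x)%:E =
   \int[lebesgue_measure]_(u in `[b, +oo[) (f (c * u) * c)%:E)%E.
Proof.
move=> f0 cf c0.
have dE : derive1 (fun z : R => c * z) = cst c.
  by apply/funext => z; rewrite derive1Ml// derive1_id mulr1.
rewrite (@increasing_ge0_integration_by_substitutiony R (fun z => c * z) f b).
- by apply: eq_integral => x _; rewrite dE.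
- by move=> x y _ _ xy; rewrite ltr_pM2l.
- by rewrite dE => ? _; exact: cvg_cst.
- by rewrite dE; exact: is_cvg_cst.
- by rewrite dE; exact: is_cvg_cst.
- split; first by move=> x _; exact: ex_derive.
  by apply: cvg_at_right_filter; exact: mulrl_continuous.
- exact: gt0_cvgMry.
- exact: continuous_subspaceT.
- by move=> x _.
Qed.

(** The factor x makes -e^(-s x^2) / (2 s) an antiderivative, and it vanishes at infinity. *)
Lemma integral_tail_gauss_radial {R : realType} (s b : R) : 0 < s -> 0 <= b ->
  (\int[lebesgue_measure]_(x in `[b, +oo[)
     (x * expR (- (s * x ^+ 2)))%:E =
   (expR (- (s * b ^+ 2)) / (2 * s))%:E)%E.
Proof.
move=> s0 b0.
pose F (x : R) := - (expR (- (s * x ^+ 2)) / (2 * s)).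
have dF (x : R) : is_derive x (1 : R) F (x * expR (- (s * x ^+ 2))).
  rewrite /F; apply: is_derive_eq.
  rewrite scaler0 add0r /GRing.scale/=.
  by field; rewrite gt_eqF.
have cF (x : R) : {for x, continuous F}.
  by apply/differentiable_continuous/derivable1_diffP; case: (dF x).
rewrite (@ge0_continuous_FTC2y R _ F _ 0).
- by rewrite sub0e -EFinN opprK.
- by move=> x bx; rewrite mulr_ge0 ?expR_ge0// (le_trans b0).
- apply: continuous_subspaceT => x; apply: cvgM; first exact: cvg_id.
  apply: continuous_comp; last exact: continuous_expR.
  apply: cvgN; apply: cvgMl_tmp; exact: exprn_continuous.
- rewrite -[X in _ --> X](_ : - (0 / (2 * s)) = 0); last by rewrite mul0r oppr0.
  apply: cvgN; apply: cvgMr_tmp.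
  apply: (cvg_comp (fun x => s * x ^+ 2) (fun x => expR (- x)));
    last exact: cvgr_expR.
  apply: (cvg_comp (fun x => x ^+ 2) ( *%R s)); first exact: cvgr_expr2.
  exact: gt0_cvgMry.
- by move=> x _; case: (dF x).
- by apply: cvg_at_right_filter; exact: cF.
- by move=> x _; rewrite derive1E; apply: derive_val.
Qed.

(** * The double Gaussian integral outside a disc *)

Section gauss_tail2.
Context {R : realType} (t : R).
Local Notation mu := (@lebesgue_measure R).
Hypothesis t_ge0 : 0 <= t.

(** The coordinates are (x, u) with y = |x| u: for x != 0, [S] describes the half y >= 0 of the
    region t <= x^2 + y^2, since x^2 + y^2 = (1 + u^2) x^2. *)
Let S : set (measurableTypeR R * measurableTypeR R) :=
  [set p | 0 <= p.2 /\ t <= (1 + p.2 ^+ 2) * p.1 ^+ 2].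

(** The substituted integrand, with Jacobian |x|. The indicator of [S] makes both iterated integrals
    range over the whole line, as Tonelli's theorem requires. *)
Let g (p : R * R) : R :=
  \1_S p * (`|p.1| * expR (- ((1 + p.2 ^+ 2) * p.1 ^+ 2))).

Let g_ge0 p : 0 <= g p.
Proof. by rewrite /g !mulr_ge0 ?expR_ge0// indicE. Qed.

Let msq : measurable_fun [set: measurableTypeR R * measurableTypeR R]
  (fun p : measurableTypeR R * measurableTypeR R =>
    (1 + p.2 ^+ 2) * p.1 ^+ 2 : measurableTypeR R).
Proof.
apply: measurable_funM.
  by apply: measurable_funD => //; apply: measurable_funX; exact: measurable_snd.
by apply: measurable_funX; exact: measurable_fst.
Qed.

Let mS : measurable S.
Proof.
rewrite (_ : S = snd @^-1` `[0, +oo[ `&`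
  (fun p : R * R => (1 + p.2 ^+ 2) * p.1 ^+ 2) @^-1` `[t, +oo[); last first.
  by apply/seteqP; split => p /=; rewrite !in_itv/= !andbT.
apply: measurableI; rewrite -[X in measurable X]setTI.
- exact: measurable_snd.
- exact: msq.
Qed.

Let mg : measurable_fun [set: measurableTypeR R * measurableTypeR R]
  (EFin \o g).
Proof.
apply/measurable_EFinP; apply: measurable_funM; first exact: measurable_indic.
apply: measurable_funM.
  by apply: measurableT_comp => //; exact: measurable_fst.
by apply: measurableT_comp => //; apply: measurableT_comp => //; exact: msq.
Qed.

(* At x = 0 the substitution y = |x| u degenerates. *)
Let inner_y x : x != 0 ->
  (\int[mu]_(y in [set y | (t <= x ^+ 2 + y ^+ 2)%R])
     (expR (- (x ^+ 2 + y ^+ 2)))%:E = 2%:E * \int[mu]_u (g (x, u))%:E)%E.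
Proof.
move=> x0; have nx0 : 0 < `|x| by rewrite normr_gt0.
(* b = 0 when t < x ^+ 2, since Num.sqrt vanishes on negative numbers. *)
pose b := Num.sqrt (t - x ^+ 2).
have b0 : 0 <= b by rewrite sqrtr_ge0.
have bE y : (b <= `|y|) = (t <= x ^+ 2 + y ^+ 2).
  rewrite /b -sqrtr_sqr ler_sqrt ?sqr_ge0//.
  by rewrite lerBlDl.
rewrite (_ : [set y | _] = [set y | b <= `|y|]); last first.
  by apply/seteqP; split => y /=; rewrite bE.
rewrite (@ge0_even_integral_tail R (fun y => expR (- (x ^+ 2 + y ^+ 2))))//;
  last 2 first.
  move=> y; apply: continuous_comp; last exact: continuous_expR.
  apply: cvgN; apply: cvgD; [exact: cvg_cst|exact: exprn_continuous].
  by move=> y; rewrite sqrrN.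
congr *%E.
(* Writing b as |x| (b / |x|) prepares the substitution y = |x| u. *)
rewrite -[b](mulrVK (unitf_gt0 nx0)) mulrC.
rewrite (@ge0_integral_tail_scale R (fun y => expR (- (x ^+ 2 + y ^+ 2))))//;
  last first.
  move=> y; apply: continuous_comp; last exact: continuous_expR.
  apply: cvgN; apply: cvgD; [exact: cvg_cst|exact: exprn_continuous].
rewrite integral_mkcond; apply: eq_integral => u _.
rewrite patchE /g/= indicE mem_setE in_itv/= andbT.
(* As b >= 0, the bound b / |x| <= u already forces u >= 0, so the half-line is exactly the section
   of [S] at x. *)
have key : (b / `|x| <= u) = ((x, u) \in S).
  rewrite ler_pdivrMr//; apply/idP/idP.
    move=> bu; have u0 : 0 <= u by rewrite -(pmulr_lge0 _ nx0) (le_trans b0).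
    apply/mem_set; split => //=.
    have : b <= `|u * `|x| | by rewrite (le_trans bu)// ler_norm.
    by rewrite bE exprMn real_normK ?num_real// mulrDl mul1r.
  move=> /set_mem[/= u0 tu].
  rewrite -[leRHS]ger0_norm ?mulr_ge0// bE.
  by rewrite exprMn real_normK ?num_real// -{1}[x ^+ 2]mul1r -mulrDl.
rewrite key; case: ifPn => _; last by rewrite mul0r.
rewrite mul1r mulrC exprMn real_normK ?num_real//.
by rewrite mulrDl mul1r [u ^+ 2 * _]mulrC.
Qed.

(** For u >= 0 the section of [S] is |x| >= b with (1 + u^2) b^2 = t. The boundary value e^(-(1 +
    u^2) b^2) is then e^(-t), independent of u, and only 1 / (1 + u^2) remains to be integrated. *)
Let inner_x u : (\int[mu]_x (g (x, u))%:E)%E =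
  (if 0 <= u then expR (- t) / (1 + u ^+ 2) else 0)%:E.
Proof.
have s0 : 0 < 1 + u ^+ 2 by rewrite ltr_pwDl// sqr_ge0.
case: ifPn => u0; last first.
  rewrite integral0_eq// => x _; rewrite /g indicE memNset ?mul0r//.
  by move=> [/=]; rewrite (negbTE u0).
pose b := Num.sqrt (t / (1 + u ^+ 2)).
have td0 : 0 <= t / (1 + u ^+ 2) by rewrite divr_ge0// ltW.
have b0 : 0 <= b by rewrite sqrtr_ge0.
transitivity (\int[mu]_(x in [set x | (b <= `|x|)%R])
    (`|x| * expR (- ((1 + u ^+ 2) * x ^+ 2)))%:E)%E.
  rewrite [RHS]integral_mkcond; apply: eq_integral => x _.
  rewrite patchE /g/= indicE.
  have -> : (x \in [set x | b <= `|x|]) = ((x, u) \in S).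
    apply/idP/idP => /set_mem h; apply/mem_set; move: h; rewrite /S/= /b.
      rewrite -sqrtr_sqr ler_sqrt ?sqr_ge0// ler_pdivrMr// mulrC.
      by move=> ?; split.
    by move=> [_]; rewrite -sqrtr_sqr ler_sqrt ?sqr_ge0// ler_pdivrMr// mulrC.
  by case: ifPn => _; rewrite ?mul1r ?mul0r.
rewrite (@ge0_even_integral_tail R
    (fun x => `|x| * expR (- ((1 + u ^+ 2) * x ^+ 2))))//; last 2 first.
  move=> x; apply: cvgM; first exact: norm_continuous.
  apply: continuous_comp; last exact: continuous_expR.
  by apply: cvgN; apply: cvgMl_tmp; exact: exprn_continuous.
  by move=> x; rewrite normrN sqrrN.
under eq_integral => x.
  rewrite inE/= in_itv/= andbT => bx.
  rewrite ger0_norm ?(le_trans b0)//.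
  over.
rewrite integral_tail_gauss_radial// -EFinM /b sqr_sqrtr//.
rewrite [X in expR (- X)]mulrC divfK ?gt_eqF//; congr EFin.
by field; rewrite gt_eqF.
Qed.

(** Exchanging the order of integration leaves 2 e^(-t) times the integral of 1 / (1 + u^2) over u
    >= 0, which is pi / 2. *)
Lemma integral2_gauss_tail :
  (\int[mu]_x \int[mu]_(y in [set y | (t <= x ^+ 2 + y ^+ 2)%R])
     (expR (- (x ^+ 2 + y ^+ 2)))%:E = (pi * expR (- t))%:E)%E.
Proof.
have mF : measurable_fun setT (fun x => \int[mu]_u (g (x, u))%:E)%E.
  have := @measurable_fun_fubini_tonelli_F _ _ _ _ _ mu (EFin \o g) mg.
  by apply => p; rewrite lee_fin.
have eqF : {in setT `\ 0, (fun x => 2%:E * \int[mu]_u (g (x, u))%:E)%E =1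
   (fun x => \int[mu]_(y in [set y | (t <= x ^+ 2 + y ^+ 2)%R])
     (expR (- (x ^+ 2 + y ^+ 2)))%:E)%E}.
  by move=> x /set_mem[_ /eqP x0]; rewrite inner_y.
have mD : measurable (setT `\ (0 : R)) by exact: measurableD.
have mF2 : measurable_fun (setT `\ (0 : R))
    (fun x => 2%:E * \int[mu]_u (g (x, u))%:E)%E.
  by apply: measurable_funTS; apply: measurable_funeM.
(* The null set {0} is removed so that [inner_y] applies, then put back before Tonelli's theorem. *)
rewrite -(@integral_setD1 R _ 0 setT)//; last exact: eq_measurable_fun eqF mF2.
transitivity (\int[mu]_(x in setT `\ 0%R)
    (2%:E * \int[mu]_u (g (x, u))%:E))%E.
  by apply: eq_integral => x Dx; rewrite -eqF.
rewrite (@integral_setD1 R _ 0 setT)//.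
rewrite ge0_integralZl//; last first.
  by move=> x _; apply: integral_ge0 => u _; rewrite lee_fin.
rewrite (@fubini_tonelli _ _ _ _ _ mu mu (EFin \o g) mg)//=.
under eq_integral do rewrite inner_x.
transitivity (2%:E * (\int[mu]_(u in `[0%R, +oo[)
   ((expR (- t))%:E * (oneDsqr u)^-1%:E)))%E.
  congr *%E; rewrite [RHS]integral_mkcond; apply: eq_integral => u _.
  by rewrite patchE mem_setE in_itv/= andbT; case: ifPn.
rewrite ge0_integralZl//; last first.
  apply/measurable_EFinP; apply: measurable_funTS.
  by apply: continuous_measurable_fun; exact: continuous_oneDsqrV.
rewrite integral0y_oneDsqr -!EFinM; congr EFin.
by field.
Qed.

End gauss_tail2.

(** * Joint law of the three complex gains *)

(** Both sides are finite measures in S that agree on rectangles, a pi-system generating the product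
    sigma-algebra. The event E carries the conditions on the other variables, so that pairs can be
    treated one after another. *)
Lemma prob_pair_of_rectangles {d d1 d2 : measure_display}
    {T : measurableType d} {T1 : measurableType d1} {T2 : measurableType d2}
    {R : realType} (P : probability T R) (nu1 : probability T1 R)
    (nu2 : probability T2 R) (E : set T) (X : T -> T1) (Y : T -> T2) :
  measurable E -> measurable_fun setT X -> measurable_fun setT Y ->
  (forall A B, measurable A -> measurable B ->
    P (E `&` (X @^-1` A `&` Y @^-1` B)) = P E * (nu1 A * nu2 B))%E ->
  forall S, measurable S ->
    P (E `&` (fun w => (X w, Y w)) @^-1` S) = (P E * (nu1 \x nu2) S)%E.
Proof.
move=> mE mX mY rect.
have mXY : measurable_fun setT (fun w => (X w, Y w)).
  exact/measurable_fun_pair.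
have k0 : 0 <= fine (P E) by rewrite fine_ge0.
(* [m1] is the image under (X, Y) of P restricted to E; [m2] is the product law scaled by P(E). *)
pose m1 : {measure set (T1 * T2) -> \bar R} :=
  measure_function_pushforward__canonical__measure_function_Measure
    (mrestr P mE) mXY.
pose m2 := mscale (NngNum k0) (nu1 \x nu2)%E.
have PE : (fine (P E))%:E = P E by rewrite fineK// fin_num_measure.
pose C : set (set (T1 * T2)) :=
  [set A `*` B | A in measurable & B in measurable].
move=> S mS.
have <- : m2 S = (P E * (nu1 \x nu2) S)%E by rewrite /m2 /mscale /= PE.
have -> : P (E `&` (fun w => (X w, Y w)) @^-1` S) = m1 S.
  by rewrite /m1 /= /pushforward /mrestr setIC.
apply: (measure_unique C (fun=> setT)) => //.
- by rewrite measurable_prod_measurableType.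
- move=> _ _ [A1 mA1 [B1 mB1 <-]] [A2 mA2 [B2 mB2 <-]].
  exists (A1 `&` A2); first exact: measurableI.
  by exists (B1 `&` B2); [exact: measurableI|rewrite setXI].
- by move=> _; exists setT => //; exists setT => //; rewrite setXTT.
- by apply: bigcup_const; exists O.
- move=> _ [A mA [B mB <-]].
  rewrite /m1 /= /pushforward /mrestr setIC [LHS](rect A B mA mB).
  by rewrite /m2 /mscale /= PE product_measure1E.
- move=> _; rewrite /m1 /= /pushforward /mrestr preimage_setT setTI.
  by rewrite -ge0_fin_numE// fin_num_measure.
Qed.

(** The law of the real or imaginary part of a CN(0,1) variable: variance 1/2 each, so that |h|^2
    has mean 1. *)
Definition normal_var_half (R : realType) : probability (measurableTypeR R) R :=
  normal_prob 0 (Num.sqrt 2^-1).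

Definition CN01 (R : realType) :
    probability (measurableTypeR R * measurableTypeR R)%type R :=
  (normal_var_half R \x normal_var_half R)%E.

Section complex_gaussian_triple.
Context {d : measure_display} {T : measurableType d} {R : realType}
  (P : probability T R) (a1 b1 a2 b2 a3 b3 : T -> R).
Hypothesis indep : indep_CN01_triple P a1 b1 a2 b2 a3 b3.

Local Notation N := (normal_var_half R).
Local Notation N2 := (CN01 R).

Let mcomp i : measurable_fun setT (six_family a1 b1 a2 b2 a3 b3 i).
Proof. by case: indep => -[]. Qed.

(** Independence is used for the full index set, with the factors grouped by complex gain. Marginal
    statements follow later by taking some of the sets to be the whole space. *)
Let boxE (A1 B1 A2 B2 A3 B3 : set R) :
  measurable A1 -> measurable B1 -> measurable A2 -> measurable B2 ->
  measurable A3 -> measurable B3 ->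
  P (a1 @^-1` A1 `&` b1 @^-1` B1 `&` (a2 @^-1` A2 `&` b2 @^-1` B2)
     `&` (a3 @^-1` A3 `&` b3 @^-1` B3)) =
  (N A1 * N B1 * (N A2 * N B2) * (N A3 * N B3))%E.
Proof.
move=> mA1 mB1 mA2 mB2 mA3 mB3.
case: indep => -[_ prodE] law.
pose C (i : 'I_6) := nth setT [:: A1; B1; A2; B2; A3; B3] i.
have mC i : measurable (C i).
  by case: i => -[|[|[|[|[|[|?]]]]]].
have := prodE [set: 'I_6]%SET C mC.
rewrite big_set/= !big_ord_recl big_ord0 /= !law//.
rewrite (_ : \bigcap_(i in _) _ =
    a1 @^-1` A1 `&` b1 @^-1` B1 `&` (a2 @^-1` A2 `&` b2 @^-1` B2)
     `&` (a3 @^-1` A3 `&` b3 @^-1` B3)).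
  move=> ->; rewrite !EFinM !fineK ?fin_num_measure// mule1.
  by rewrite !muleA.
apply/seteqP; split => w.
  move=> h; have hi k (k6 : (k < 6)%N) := h (Ordinal k6) (finset.in_setT _).
  do !split.
  - exact: (hi 0 isT).
  - exact: (hi 1 isT).
  - exact: (hi 2 isT).
  - exact: (hi 3 isT).
  - exact: (hi 4 isT).
  - exact: (hi 5 isT).
by move=> [[[? ?] [? ?]] [? ?]] [[|[|[|[|[|[|?]]]]]] ?] _.
Qed.

Let ma1 : measurable_fun setT a1. Proof. exact: (mcomp (@Ordinal 6 0 isT)). Qed.
Let mb1 : measurable_fun setT b1. Proof. exact: (mcomp (@Ordinal 6 1 isT)). Qed.
Let ma2 : measurable_fun setT a2. Proof. exact: (mcomp (@Ordinal 6 2 isT)). Qed.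
Let mb2 : measurable_fun setT b2. Proof. exact: (mcomp (@Ordinal 6 3 isT)). Qed.
Let ma3 : measurable_fun setT a3. Proof. exact: (mcomp (@Ordinal 6 4 isT)). Qed.
Let mb3 : measurable_fun setT b3. Proof. exact: (mcomp (@Ordinal 6 5 isT)). Qed.

Let mpre (f : T -> R) (A : set R) :
  measurable_fun setT f -> measurable A -> measurable (f @^-1` A).
Proof. by move=> mf mA; rewrite -[_ @^-1` _]setTI; exact: mf. Qed.

Let mpre2 (f g : T -> R) (S : set (measurableTypeR R * measurableTypeR R)) :
  measurable_fun setT f -> measurable_fun setT g -> measurable S ->
  measurable ((fun w => (f w, g w)) @^-1` S).
Proof.
move=> mf mg mS; rewrite -[_ @^-1` _]setTI.
by apply: (measurable_fun_pair mf mg).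
Qed.

Local Notation h1 := (fun w => (a1 w, b1 w)).
Local Notation h2 := (fun w => (a2 w, b2 w)).
Local Notation h3 := (fun w => (a3 w, b3 w)).

Let N_T : N setT = 1%E. Proof. exact: probability_setT. Qed.

(** In [box1], [box2] and [box3], rectangles give way to arbitrary planar sets, one gain at a time.
    The event on the other gains serves as E, and its probability [rest] comes from the preceding
    box formula. *)
Let box1 S1 A2 B2 A3 B3 : measurable S1 ->
  measurable A2 -> measurable B2 -> measurable A3 -> measurable B3 ->
  P (h1 @^-1` S1 `&` (a2 @^-1` A2 `&` b2 @^-1` B2)
     `&` (a3 @^-1` A3 `&` b3 @^-1` B3)) =
  (N2 S1 * (N A2 * N B2) * (N A3 * N B3))%E.
Proof.
move=> mS1 mA2 mB2 mA3 mB3; rewrite -setIA setIC.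
have rest : P (a2 @^-1` A2 `&` b2 @^-1` B2 `&` (a3 @^-1` A3 `&` b3 @^-1` B3)) =
    (N A2 * N B2 * (N A3 * N B3))%E.
  have := @boxE setT setT A2 B2 A3 B3 measurableT measurableT mA2 mB2 mA3 mB3.
  by rewrite !preimage_setT !setTI N_T !mul1e.
rewrite (@prob_pair_of_rectangles _ _ _ _ _ _ _ P N N)//.
- by rewrite rest muleC muleA.
- by apply: measurableI; apply: measurableI; exact: mpre.
- move=> A B mA mB; rewrite setIC setIA boxE// rest -muleA.
  exact: muleC.
Qed.

Let box2 S1 S2 A3 B3 : measurable S1 -> measurable S2 ->
  measurable A3 -> measurable B3 ->
  P (h1 @^-1` S1 `&` h2 @^-1` S2 `&` (a3 @^-1` A3 `&` b3 @^-1` B3)) =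
  (N2 S1 * N2 S2 * (N A3 * N B3))%E.
Proof.
move=> mS1 mS2 mA3 mB3; rewrite setIAC.
have rest : P (h1 @^-1` S1 `&` (a3 @^-1` A3 `&` b3 @^-1` B3)) =
    (N2 S1 * (N A3 * N B3))%E.
  have := @box1 S1 setT setT A3 B3 mS1 measurableT measurableT mA3 mB3.
  by rewrite !preimage_setT !setIT N_T !mule1.
rewrite (@prob_pair_of_rectangles _ _ _ _ _ _ _ P N N)//.
- by rewrite rest muleAC.
- by apply: measurableI; [exact: mpre2|apply: measurableI; exact: mpre].
- by move=> A B mA mB; rewrite setIAC box1// rest muleAC.
Qed.

Let box3 S1 S2 S3 : measurable S1 -> measurable S2 -> measurable S3 ->
  P (h1 @^-1` S1 `&` h2 @^-1` S2 `&` h3 @^-1` S3) = (N2 S1 * N2 S2 * N2 S3)%E.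
Proof.
move=> mS1 mS2 mS3.
have rest : P (h1 @^-1` S1 `&` h2 @^-1` S2) = (N2 S1 * N2 S2)%E.
  have := @box2 S1 S2 setT setT mS1 mS2 measurableT measurableT.
  by rewrite !preimage_setT !setIT N_T !mule1.
rewrite (@prob_pair_of_rectangles _ _ _ _ _ _ _ P N N)//.
- by rewrite rest.
- by apply: measurableI; exact: mpre2.
- by move=> A B mA mB; rewrite box2// rest.
Qed.

(** The third gain is put before the second because the product measure integrates over its first
    coordinate last: this is the gain on which the computation conditions. *)
Lemma CN01_triple_law S1 S : measurable S1 -> measurable S ->
  P (h1 @^-1` S1 `&` (fun w => (h3 w, h2 w)) @^-1` S) =
  (N2 S1 * (N2 \x N2) S)%E.
Proof.
move=> mS1 mS.
have rest : P (h1 @^-1` S1) = N2 S1.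
  have := @box3 S1 setT setT mS1 measurableT measurableT.
  by rewrite !preimage_setT !setIT probability_setT !mule1.
rewrite (@prob_pair_of_rectangles _ _ _ _ _ _ _ P N2 N2)//.
- by rewrite rest.
- exact: mpre2.
- exact/measurable_fun_pair.
- exact/measurable_fun_pair.
- move=> A B mA mB; rewrite [X in _ `&` X]setIC setIA box3// rest.
  by rewrite -muleA [X in (_ * X)%E]muleC.
Qed.

End complex_gaussian_triple.

(** * Integration against N(0, 1/2) and CN(0,1) *)

Section normal_var_half.
Context {R : realType}.
Local Notation mu := (@lebesgue_measure R).
Local Notation N := (normal_var_half R).

Let half_gt0 : 0 < Num.sqrt (2^-1 : R).
Proof. by rewrite sqrtr_gt0 invr_gt0. Qed.

Lemma normal_pdf_var_half (x : R) :
  normal_pdf 0 (Num.sqrt 2^-1) x = (Num.sqrt pi)^-1 * expR (- x ^+ 2).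
Proof.
rewrite normal_pdfE ?gt_eqF// /normal_peak /normal_fun subr0.
rewrite sqr_sqrtr ?invr_ge0// -mulrnAr -[pi *+ 2]mulr_natr mulrCA mulVf//.
by rewrite mulr1 -[2^-1 *+ 2]mulr_natr mulVf// divr1.
Qed.

(* The Gaussian density is a version of the Radon-Nikodym derivative of N. *)
Lemma integral_normal_var_half (f : R -> \bar R) :
  N.-integrable setT f ->
  (\int[N]_x f x =
   \int[mu]_x (f x * ((Num.sqrt pi)^-1 * expR (- x ^+ 2))%:E))%E.
Proof.
move=> intf.
have dom : normal_prob 0 (Num.sqrt 2^-1 : R) `<< mu
  by exact: normal_prob_dominates.
rewrite -(Radon_Nikodym_change_of_variables dom)//=.
under [RHS]eq_integral do rewrite -normal_pdf_var_half.
have mf : measurable_fun setT f by apply: (measurable_int N).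
have mpdf : measurable_fun setT
    (EFin \o normal_pdf 0 (Num.sqrt 2^-1) : R -> \bar R).
  by apply/measurable_EFinP; exact: measurable_normal_pdf.
apply: ae_eq_integral => //.
- exact: emeasurable_funM.
- exact: emeasurable_funM.
(* Two densities with equal integrals over every measurable set agree almost everywhere. *)
- apply: ae_eqe_mul2l => /=; rewrite Radon_NikodymE/=.
  case: cid => h [h1 h2 h3] /=.
  by apply: integral_ae_eq => //= E _ mE; rewrite -h3.
Qed.

End normal_var_half.

Section CN01_integrals.
Context {R : realType}.
Local Notation mu := (@lebesgue_measure R).
Local Notation N := (normal_var_half R).
Local Notation RR := (measurableTypeR R * measurableTypeR R)%type.

Lemma measurable_abs2 :
  measurable_fun [set: RR] (fun p : RR => abs2 p.1 p.2 : measurableTypeR R).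
Proof.
by apply: measurable_funD; apply: measurable_funX;
  [exact: measurable_fst|exact: measurable_snd].
Qed.

Lemma measurable_abs2_ge (t : R) : measurable [set p : RR | t <= abs2 p.1 p.2].
Proof.
rewrite (_ : [set p | _] = (fun p : RR => abs2 p.1 p.2) @^-1` `[t, +oo[).
  by rewrite -[X in measurable X]setTI; exact: measurable_abs2.
by apply/seteqP; split => p /=; rewrite in_itv/= andbT.
Qed.

Let integrable_bounded (f : R -> \bar R) : measurable_fun setT f ->
  (forall x, 0 <= f x <= 1)%E -> N.-integrable setT f.
Proof.
move=> mf f01; apply/integrableP; split => //.
apply: (@le_lt_trans _ _ (\int[N]_x cst 1 x)%E).
  apply: ge0_le_integral => //; first exact: measurableT_comp.
  by move=> x _; have /andP[? ?] := f01 x; rewrite gee0_abs.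
by rewrite integral_cst// mul1e -ge0_fin_numE// fin_num_measure.
Qed.

Let sqrt_pi_gt0 : 0 < Num.sqrt (pi : R).
Proof. by rewrite sqrtr_gt0 pi_gt0. Qed.

(** In terms of densities, the left-hand side is 1 / pi times the integral computed in
    [integral2_gauss_tail]. *)
Lemma CN01_abs2_ge (t : R) : 0 <= t ->
  CN01 R [set p | t <= abs2 p.1 p.2] = (expR (- t))%:E.
Proof.
move=> t0.
pose E : set RR := [set p | t <= abs2 p.1 p.2].
have mE : measurable E by exact: measurable_abs2_ge.
rewrite /CN01 /= /product_measure1 /=.
have mN : measurable_fun setT (fun x => N (xsection E x)).
  exact: measurable_fun_xsection.
rewrite integral_normal_var_half; last first.
  apply: integrable_bounded => // x; rewrite measure_ge0/=.
  by apply: probability_le1; exact: measurable_xsection.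
have sectE x : xsection E x = [set y | t <= x ^+ 2 + y ^+ 2].
  by apply/seteqP; split => y; rewrite /xsection/= inE.
pose h x := (N (xsection E x) * ((Num.sqrt pi)^-1 * expR (- x ^+ 2))%:E)%E.
transitivity (\int[mu]_x h x)%E; first by [].
have h0 x : (0 <= h x)%E.
  by rewrite /h mule_ge0// lee_fin mulr_ge0 ?expR_ge0// invr_ge0 ltW.
have mh : measurable_fun setT h.
  apply: emeasurable_funM => //; apply/measurable_EFinP.
  apply: measurable_funM => //; apply: measurableT_comp => //.
  exact: measurableT_comp.
(* Of the factor pi = sqrt(pi)^2, one root cancels the constant of the outer density and the other
   that of the inner density. *)
have hE x : (pi%:E * h x =
    \int[mu]_(y in [set y | (t <= x ^+ 2 + y ^+ 2)%R])
      (expR (- (x ^+ 2 + y ^+ 2)))%:E)%E.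
  have mx : measurable [set y | t <= x ^+ 2 + y ^+ 2].
    by rewrite -sectE; exact: measurable_xsection.
  rewrite /h sectE muleCA -EFinM [RHS](_ : _ =
      \int[mu]_(y in [set y | (t <= x ^+ 2 + y ^+ 2)%R])
        ((Num.sqrt pi * expR (- x ^+ 2))%:E *
         (normal_pdf 0 (Num.sqrt 2^-1) y)%:E))%E.
    rewrite ge0_integralZl//.
    - rewrite muleC; congr (_%:E * _)%E.
      rewrite mulrA; congr (_ * _).
      by rewrite -{1}(sqr_sqrtr (pi_ge0 R)) expr2 mulfK// gt_eqF.
    - apply/measurable_EFinP/measurable_funTS; exact: measurable_normal_pdf.
    - by move=> y _; rewrite lee_fin normal_pdf_ge0.
  apply: eq_integral => y _; rewrite normal_pdf_var_half -EFinM; congr EFin.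
  by rewrite opprD expRD mulrACA divff ?gt_eqF// mul1r.
have : (pi%:E * \int[mu]_x h x = (pi * expR (- t))%:E)%E.
  rewrite -ge0_integralZl ?lee_fin ?pi_ge0//.
  under eq_integral do rewrite hE.
  exact: integral2_gauss_tail.
move=> /(congr1 (fun z => (pi^-1%:E * z)%E)).
by rewrite muleA -!EFinM mulrA mulVf ?gt_eqF ?pi_gt0// !mul1r mul1e.
Qed.

(** Times the density, the integrand is 1 / sqrt(1 + k) times the density of a centred normal law of
    variance 1 / (2 (1 + k)). Its standard deviation is [s], and its density integrates to 1. *)
Lemma integral_normal_var_half_gauss (k : R) : 0 <= k ->
  (\int[N]_x (expR (- (k * x ^+ 2)))%:E = ((Num.sqrt (1 + k))^-1)%:E)%E.
Proof.
move=> k0.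
have k1 : 0 < 1 + k by rewrite ltr_pwDl.
have mexp c : measurable_fun setT (fun x : R => expR (- (c * x ^+ 2))).
  apply: measurableT_comp => //; apply: measurableT_comp => //.
  exact: measurable_funM.
rewrite integral_normal_var_half; last first.
  apply: integrable_bounded; first exact/measurable_EFinP.
  move=> x; rewrite !lee_fin expR_ge0/= -expR0 ler_expR oppr_le0.
  by rewrite mulr_ge0// sqr_ge0.
pose s := Num.sqrt ((2 * (1 + k))^-1).
have s0 : s != 0 by rewrite gt_eqF// sqrtr_gt0 invr_gt0 mulr_gt0.
have s2 : s ^+ 2 *+ 2 = (1 + k)^-1.
  rewrite /s sqr_sqrtr ?invr_ge0 ?mulr_ge0 ?(ltW k1)//.
  by rewrite invfM -mulr_natr mulrAC mulVf// mul1r.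
have peak : normal_peak s = Num.sqrt (1 + k) / Num.sqrt pi.
  rewrite /normal_peak -mulrnAl s2 sqrtrM ?invr_ge0 ?(ltW k1)//.
  by rewrite sqrtrV ?(ltW k1)// invfM invrK.
rewrite -[RHS]mule1 -(integral_normal_pdf 0 s) -ge0_integralZl//; last 2 first.
- by apply/measurable_EFinP; exact: measurable_normal_pdf.
- by move=> y _; rewrite lee_fin normal_pdf_ge0.
apply: eq_integral => x _; rewrite normal_pdfE// peak /normal_fun s2 subr0.
rewrite invrK -!EFinM !mulrA mulVf ?gt_eqF ?sqrtr_gt0// mul1r.
congr EFin; rewrite mulrAC -expRD mulrC; congr (_ * expR _).
by ring.
Qed.

(** This is the Laplace transform of a mean-one exponential variable; the integrand factors over the
    two components. *)
Lemma integral_CN01_gauss (k : R) : 0 <= k ->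
  (\int[CN01 R]_p (expR (- (k * abs2 p.1 p.2)))%:E = ((1 + k)^-1)%:E)%E.
Proof.
move=> k0.
have k1 : 0 < 1 + k by rewrite ltr_pwDl.
have mf : measurable_fun [set: RR]
    (fun p : RR => (expR (- (k * abs2 p.1 p.2)))%:E).
  apply/measurable_EFinP; apply: measurableT_comp => //.
  apply: measurableT_comp => //; apply: measurable_funM => //.
  exact: measurable_abs2.
transitivity (\int[N]_x \int[N]_y (expR (- (k * abs2 x y)))%:E)%E.
  exact: (fubini_tonelli1 _ mf).
have inner x : (\int[N]_y (expR (- (k * abs2 x y)))%:E =
    (expR (- (k * x ^+ 2)))%:E * ((Num.sqrt (1 + k))^-1)%:E)%E.
  rewrite -integral_normal_var_half_gauss// -ge0_integralZl//.
  - apply: eq_integral => y _; rewrite -EFinM -expRD; congr (expR _)%:E.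
    by rewrite /abs2; ring.
  - apply/measurable_EFinP; apply: measurableT_comp => //.
    by apply: measurableT_comp => //; exact: measurable_funM.
under eq_integral do rewrite inner.
rewrite ge0_integralZr//; last first.
  apply/measurable_EFinP; apply: measurableT_comp => //.
  by apply: measurableT_comp => //; exact: measurable_funM.
rewrite integral_normal_var_half_gauss// -EFinM -invfM -expr2 sqr_sqrtr//.
exact: ltW.
Qed.

End CN01_integrals.

(** * The outage event and its probability *)

Lemma le_log2 {R : realType} (r x : R) : 0 < x -> (r <= log2 x) = (2 `^ r <= x).
Proof.
move=> x0; rewrite /log2 ler_pdivlMr ?ln_gt0 ?ltr1n//.
by rewrite -ln_powR ler_ln ?posrE ?powR_gt0.
Qed.

Lemma le_secrecy_capacity1 {R : realType} (gR gD gE r x y z : R) :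
  0 < gR -> 0 < gD -> 0 < gE -> 0 < r -> 0 <= x -> 0 <= y -> 0 <= z ->
  (r <= secrecy_capacity1 gR gD gE x y z) =
  ((2 `^ r - 1) / gR <= x) &&
  ((2 `^ r - 1) / gD + 2 `^ r / gD * gE * z <= y).
Proof.
move=> gR0 gD0 gE0 r0 x0 y0 z0.
rewrite /secrecy_capacity1 /rate_RD /rate_SR.
(* Since r > 0, the zero branch of either maximum never reaches r. *)
rewrite le_max [r <= 0]leNgt r0 orbF le_min le_max [r <= 0]leNgt r0 orbF.
have dx : 0 < 1 + gR * x by rewrite ltr_pwDl// mulr_ge0// ltW.
have dy : 0 < 1 + gD * y by rewrite ltr_pwDl// mulr_ge0// ltW.
have dz : 0 < 1 + gE * z by rewrite ltr_pwDl// mulr_ge0// ltW.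
rewrite !le_log2 ?divr_gt0// andbC; congr andb.
  by rewrite ler_pdivrMr// lerBlDl [x * gR]mulrC.
(* Multiplied by gD and shifted by 1, the threshold condition on y becomes 2^r (1 + gE z) <= 1 + gD
   y. *)
rewrite ler_pdivlMr// -[RHS](ler_pM2l gD0) -[RHS](lerD2l 1).
by congr (_ <= _); field; rewrite gt_eqF.
Qed.

(** For a fixed first gain p the tail formula applies at the nonnegative threshold c + k |p|^2. The
    exponential splits, and averaging over p gives the second factor. *)
Lemma CN01_pair_abs2_ge {R : realType} (c k : R) : 0 <= c -> 0 <= k ->
  (CN01 R \x CN01 R)%E [set q | c + k * abs2 q.1.1 q.1.2 <= abs2 q.2.1 q.2.2] =
  (expR (- c) * (1 + k)^-1)%:E.
Proof.
move=> c0 k0; rewrite /product_measure1/=.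
under eq_integral => p _.
  rewrite (_ : xsection _ p =
      [set q | c + k * abs2 p.1 p.2 <= abs2 q.1 q.2]); last first.
    by apply/seteqP; split => q; rewrite /xsection/= inE.
  rewrite CN01_abs2_ge; last first.
    by rewrite addr_ge0// mulr_ge0// addr_ge0 ?sqr_ge0.
  rewrite opprD expRD EFinM.
  over.
rewrite ge0_integralZl//; last first.
  apply/measurable_EFinP; apply: measurableT_comp => //.
  apply: measurableT_comp => //; apply: measurable_funM => //.
  exact: measurable_abs2.
by rewrite integral_CN01_gauss// -EFinM.
Qed.

Theorem theorem1 (R : realType) (d : measure_display) (T : measurableType d)
    (P : probability T R) (gR gD gE Rt : R)
    (aSR bSR aRD bRD aRE bRE : T -> R) :
  0 < gR -> 0 < gD -> 0 < gE -> 0 < Rt ->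
  indep_CN01_triple P aSR bSR aRD bRD aRE bRE ->
  P [set w | secrecy_capacity1 gR gD gE
               (abs2 (aSR w) (bSR w)) (abs2 (aRD w) (bRD w))
               (abs2 (aRE w) (bRE w)) < Rt] =
  (1 - expR (- ((2 `^ Rt - 1) / gR) - (2 `^ Rt - 1) / gD)
       * (1 + 2 `^ Rt / gD * gE)^-1)%:E.
Proof.
move=> gR0 gD0 gE0 Rt0 indep.
have pow_ge1 : 0 <= 2 `^ Rt - 1.
  by rewrite subr_ge0 -[leLHS](powRr0 2) ler_powR ?ler1n// ltW.
pose c := (2 `^ Rt - 1) / gD; pose k := 2 `^ Rt / gD * gE.
have c0 : 0 <= c by rewrite divr_ge0// ltW.
have k0 : 0 <= k by rewrite mulr_ge0 ?divr_ge0 ?powR_ge0// ltW.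
pose S1 : set (measurableTypeR R * measurableTypeR R) :=
  [set p | (2 `^ Rt - 1) / gR <= abs2 p.1 p.2].
pose S : set ((measurableTypeR R * measurableTypeR R) *
              (measurableTypeR R * measurableTypeR R)) :=
  [set q | c + k * abs2 q.1.1 q.1.2 <= abs2 q.2.1 q.2.2].
have mS1 : measurable S1 by exact: measurable_abs2_ge.
have mS : measurable S.
  rewrite (_ : S = (fun q => abs2 q.2.1 q.2.2 - k * abs2 q.1.1 q.1.2)
      @^-1` `[c, +oo[); last first.
    by apply/seteqP; split => q /=; rewrite in_itv/= andbT lerBrDr.
  rewrite -[X in measurable X]setTI; apply: measurable_funB => //.
    exact: (measurableT_comp measurable_abs2 measurable_snd).
  apply: measurable_funM => //.
  exact: (measurableT_comp measurable_abs2 measurable_fst).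
(* [A] is the event of no outage, ordered as in [CN01_triple_law]: relay gain, then the pair of
   eavesdropper and destination gains. *)
pose A := (fun w => (aSR w, bSR w)) @^-1` S1 `&`
  (fun w => ((aRE w, bRE w), (aRD w, bRD w))) @^-1` S.
rewrite (_ : [set w | _] = ~` A); last first.
  apply/seteqP; split => w /=;
    rewrite ltNge le_secrecy_capacity1 ?addr_ge0 ?sqr_ge0//.
    by move=> /negP h [h1 h2]; apply: h; apply/andP.
  by move=> h; apply/negP => /andP[h1 h2]; apply: h.
have mcomp := indep.1.1.
have mA : measurable A.
  apply: measurableI; rewrite -[X in measurable X]setTI.
    by apply: (measurable_fun_pair (mcomp (@Ordinal 6 0 isT))
      (mcomp (@Ordinal 6 1 isT))).
  by apply: (measurable_fun_pair
    (measurable_fun_pair (mcomp (@Ordinal 6 4 isT)) (mcomp (@Ordinal 6 5 isT)))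
    (measurable_fun_pair (mcomp (@Ordinal 6 2 isT)) (mcomp (@Ordinal 6 3 isT)))).
rewrite probability_setC// (CN01_triple_law _ _ _ _ _ _ _ indep)//.
rewrite CN01_abs2_ge ?divr_ge0// ?(ltW gR0)// CN01_pair_abs2_ge//.
by rewrite -EFinM mulrA -expRD -EFinB.
Qed.
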